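(* There exists a numerical constant $c>0$ such that the following holds. Let $d,N\ge1$ be integers, let $\mathcal A_1\subset\mathcal B(H_1)$ be a unital $C^*$-algebra, and let $a_0,a_1,\ldots,a_{2d}\in\mathcal A_1$. Let $\sigma=(\sigma_1,\ldots,\sigma_d)$ be permutations of $\{1,\ldots,N\}$ with permutation matrices $U_1,\ldots,U_d$, and set $U_{i+d}=U_i^*$ for $1\le i\le d$. Let $$A_{\mathrm F}=a_0\otimes 1+\sum_{i=1}^{2d}a_i\otimes\lambda(g_i)\in\mathcal A_1\otimes\mathcal A_{\mathrm F},\qquad A_N=a_0\otimes 1+\sum_{i=1}^{2d}a_i\otimes U_i\in\mathcal A_1\otimes M_N(\mathbb C).$$ Let $p\ge1$ be an integer and assume that there exist $x,y\in\{1,\ldots,N\}$ such that $(G_\sigma,x)_p$ and $(G_\sigma,y)_p$ are disjoint and without cycle. Then $$\|A_N\Pi_N\|\ge\|A_{\mathrm F}\|\left(1-c\,\frac{\sqrt{\log(2d)}}{\sqrt p}\right).$$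
   Context: Tensor products of $C^*$-algebras are minimal. $\mathrm F_d$ is the free group with free generators $g_1,\ldots,g_d$; for $d+1\le i\le 2d$, $g_i=g_{i-d}^{-1}$. $\lambda$ is the left regular representation on $\ell^2(\mathrm F_d)$, $\lambda(g)\delta_h=\delta_{gh}$, and $\mathcal A_{\mathrm F}$ is the reduced $C^*$-algebra generated by the $\lambda(g)$. $\Pi_N=1_{H_1}\otimes(1_{\mathbb C^N}-\mathbf 1_N\otimes\mathbf 1_N)$, where $\mathbf 1_N\in\mathbb C^N$ is the unit vector with all coordinates $1/\sqrt N$ and $\mathbf 1_N\otimes\mathbf 1_N$ denotes the orthogonal projection onto $\mathbb C\mathbf 1_N$. $G_\sigma$ is the Schreier graph of $\sigma$: the (multi)graph on $\{1,\ldots,N\}$ whose adjacency matrix is $\sum_{i=1}^{2d}U_i$ (loops and multiple edges count as cycles). For $h>0$, $(G_\sigma,x)_h$ is the subgraph of $G_\sigma$ spanned by the vertices at graph distance at most $h$ from $x$. $\|\cdot\|$ is the operator norm. A numerical constant is one independent of all parameters. *)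

(* Defs.v *)
From HB Require Import structures.
From mathcomp Require Import all_boot all_order all_fingroup all_algebra complex.
From mathcomp Require Import all_classical all_reals all_analysis.
Import Order.TTheory GRing.Theory Num.Theory.
Import numFieldNormedType.Exports.

Set Implicit Arguments.
Unset Strict Implicit.
Unset Printing Implicit Defensive.

Local Open Scope classical_set_scope.
Local Open Scope ring_scope.
Local Open Scope complex_scope.

(* The free group F_d is the set of reduced words in the letters (j, false),
   standing for the free generator g_j, and (j, true), standing for its
   inverse; words are multiplied by concatenation and free reduction. *)
Section FreeGroup.
Variable d : nat.
Implicit Types (l m : 'I_d * bool) (u v w : seq ('I_d * bool)).

Definition linv l := (l.1, ~~ l.2).

Definition reduced w := sorted (fun l m => m != linv l) w.

Definition push l w :=
  if w is m :: w' then if m == linv l then w' else l :: w else [:: l].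

Definition word_mul u v := foldr push v u.
Definition word_inv w := map linv (rev w).

Lemma linvK : involutive linv.
Proof. by case=> j b; rewrite /linv /= negbK. Qed.

Lemma reduced_push l w : reduced w -> reduced (push l w).
Proof.
case: w => [//|m w] /= rw; case: eqP => [_|/eqP ne] /=; last by rewrite ne.
exact: path_sorted rw.
Qed.

Lemma pushK l w : reduced w -> push (linv l) (push l w) = w.
Proof.
case: w => [|m w] /=; first by rewrite linvK eqxx.
case: eqP => [->|/eqP ne] /=; last by rewrite linvK eqxx.
case: w => [//|n w] /= /andP[ne _].
by rewrite (negPf ne).
Qed.

Lemma reduced_mul u v : reduced v -> reduced (word_mul u v).
Proof. by move=> rv; elim: u => //= l u IH; apply: reduced_push. Qed.

Lemma word_mul_push l u v : reduced v -> reduced u ->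
  word_mul (push l u) v = push l (word_mul u v).
Proof.
move=> rv; case: u => [//|m u] /= ru; case: eqP => [->|//].
by rewrite -{1}[l]linvK pushK // reduced_mul.
Qed.

Lemma word_mulA u v w : reduced v -> reduced w ->
  word_mul u (word_mul v w) = word_mul (word_mul u v) w.
Proof.
move=> rv rw; elim: u => //= l u ->.
by rewrite word_mul_push // reduced_mul.
Qed.

Lemma word_mulw1 w : reduced w -> word_mul w [::] = w.
Proof.
elim: w => [//|l w IH] rw.
rewrite -[word_mul _ _]/(push l (word_mul w [::])) IH; last first.
  exact: path_sorted rw.
by case: w rw {IH} => //= m w /andP[/negPf ->].
Qed.

Lemma word_mulVw w : word_mul (word_inv w) w = [::].
Proof.
elim: w => //= l w IH.
by rewrite /word_inv rev_cons map_rcons /word_mul foldr_rcons /= linvK eqxx.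
Qed.

Lemma word_invK w : word_inv (word_inv w) = w.
Proof.
by rewrite /word_inv -map_rev revK -map_comp map_id_in // => l _; exact: linvK.
Qed.

Lemma reduced_inv w : reduced w -> reduced (word_inv w).
Proof.
rewrite /reduced /word_inv map_rev rev_sorted sorted_map.
apply: sub_sorted => l m /=; apply: contraNN => /eqP /(can_inj linvK) ->.
by rewrite linvK.
Qed.

Definition free_group := {w : seq ('I_d * bool) | reduced w}.
HB.instance Definition _ := Choice.on free_group.

Implicit Types x y : free_group.
Definition fg_one : free_group := exist _ [::] isT.
Definition fg_mul x y : free_group :=
  exist _ (word_mul (val x) (val y)) (reduced_mul (val x) (valP y)).
Definition fg_inv x : free_group :=
  exist _ (word_inv (val x)) (reduced_inv (valP x)).

Lemma fg_mulA : associative fg_mul.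
Proof. by move=> x y z; apply/val_inj/word_mulA; exact: valP. Qed.
Lemma fg_mul1 : left_id fg_one fg_mul.
Proof. by move=> x; apply/val_inj. Qed.
Lemma fg_mulr1 : right_id fg_one fg_mul.
Proof. by move=> x; apply/val_inj/word_mulw1/valP. Qed.
Lemma fg_mulV : left_inverse fg_one fg_inv fg_mul.
Proof. by move=> x; apply/val_inj/word_mulVw. Qed.
Lemma fg_mulrV : right_inverse fg_one fg_inv fg_mul.
Proof.
by move=> x; apply/val_inj => /=; rewrite -{1}[val x]word_invK word_mulVw.
Qed.

HB.instance Definition _ := isGroup.Build free_group
  fg_mulA fg_mul1 fg_mulr1 fg_mulV fg_mulrV.

Definition fgen (j : 'I_d) : free_group := exist _ [:: (j, false)] isT.

(* The first d indices are the generators, the last d their inverses. *)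
Definition fgen2 (i : 'I_(d + d)) : free_group :=
  match fintype.split i with inl j => fgen j | inr j => (fgen j)^-1%g end.

(* Universal property: free_group is free on the fgen j. *)
Lemma free_groupP (G : groupType) (f : 'I_d -> G) :
  exists2 phi : free_group -> G,
    {morph phi : x y / (x * y)%g} /\ (forall j, phi (fgen j) = f j) &
    forall psi : free_group -> G, {morph psi : x y / (x * y)%g} ->
      (forall j, psi (fgen j) = f j) -> psi =1 phi.
Proof.
pose fl l := if l.2 then (f l.1)^-1%g else f l.1.
have flV l : fl (linv l) = (fl l)^-1%g.
  by case: l => j [] //=; rewrite /fl /= invgK.
pose F w : G := foldr (fun l g => (fl l * g)%g) 1%g w.
have Fpush l w : F (push l w) = (fl l * F w)%g.
  case: w => [//|m w] /=; case: eqP => [->|//] /=.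
  by rewrite flV mulgA mulgV mul1g.
have FM u v : F (word_mul u v) = (F u * F v)%g.
  by elim: u => [|l u IH] /=; rewrite ?mul1g // Fpush IH mulgA.
exists (fun x => F (val x)).
  by split=> [x y|j]; [exact: FM | rewrite /= /fl /= mulg1].
move=> psi psiM psif [w rw] /=.
have psi1 : psi 1%g = 1%g.
  by apply: (@mulgI _ (psi 1%g)); rewrite -psiM !mulg1.
elim: w rw => [|l w IH] rw /=.
  by rewrite -psi1; congr psi; apply/val_inj.
have rw' : reduced w by exact: path_sorted rw.
pose gl : free_group := exist _ [:: l] isT.
have -> : exist _ (l :: w) rw = (gl * exist _ w rw')%g :> free_group.
  apply/val_inj => /=; rewrite /word_mul /=.
  by case: w rw {IH rw'} => //= m w /andP[/negPf ->].
rewrite psiM IH; congr (_ * _)%g.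
case: l {rw} @gl => j [] /=; rewrite /fl /= -psif; last first.
  by congr psi; apply/val_inj.
apply: (@mulgI _ (psi (fgen j))); rewrite mulgV -psiM -psi1; congr psi.
by apply/val_inj; rewrite /= /word_mul /= /linv /= eqxx.
Qed.

End FreeGroup.

Section Operators.
Variables (R : realType) (H : completeNormedModType R[i]).

(* H is a Hilbert space with inner product ip *)
Definition hilbert_inner (ip : {dot H for Num.conj}) : Prop :=
  forall x : H, ip x x = `|x| ^+ 2.

(* the elements of B(H) *)
Definition bounded_op (a : H -> H) : Prop := linear a /\ continuous a.

Record cstar_subalgebra (ip : {dot H for Num.conj}) (A : set (H -> H)) : Prop :=
  CstarSubalgebra {
    cstar_bounded : A `<=` bounded_op;
    cstar_zero : A (fun=> 0);
    cstar_add : forall a b, A a -> A b -> A (fun x => a x + b x);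
    cstar_scale : forall (k : R[i]) a, A a -> A (fun x => k *: a x);
    cstar_mul : forall a b, A a -> A b -> A (a \o b);
    cstar_adj : forall a, A a ->
      exists2 b, A b & forall x y, ip (a x) y = ip x (b y);
    cstar_closed : forall b, bounded_op b ->
      (forall e : R[i], 0 < e ->
         exists2 a, A a & forall x, `|b x - a x| <= e * `|x|) -> A b
  }.

Definition unital_cstar_subalgebra ip (A : set (H -> H)) : Prop :=
  cstar_subalgebra ip A /\
  exists2 e, A e & forall a, A a -> e \o a = a /\ a \o e = a.

(* The Hilbert space tensor product of H and l^2(S) is l^2(S; H), the
   elementary tensor x (x) xi being s |-> xi(s) x.  Its vectors are the functions
   f with l2norm f < +oo. *)
Definition l2norm (S : choiceType) (f : S -> H) : \bar R :=
  sqrte (\esum_(s in [set: S]) ((complex.Re `|f s|) ^+ 2)%:E).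

Definition opnorm (S : choiceType) (T : (S -> H) -> (S -> H)) : \bar R :=
  ereal_sup [set l2norm (T f) | f in [set f | (l2norm f <= 1)%E]].

Definition elem_tensor (S : choiceType) (x : H) (xi : S -> R[i]) : S -> H :=
  fun s => xi s *: x.

Section FreeSide.
Variable d : nat.
Local Notation F := (free_group d).

(* a (x) lambda(g), where lambda(g) delta_h = delta_{gh}, i.e.
   (lambda(g) xi)(h) = xi(g^-1 h) *)
Definition tens_lambda (a : H -> H) (g : F) (f : F -> H) : F -> H :=
  fun h => a (f (g^-1 * h)%g).

Lemma tens_lambda_delta a g x h : linear a ->
  tens_lambda a g (elem_tensor x (fun t : F => (t == h)%:R)) =
  elem_tensor (a x) (fun t : F => (t == (g * h)%g)%:R).
Proof.
move=> la; apply/funext => t; rewrite /tens_lambda /elem_tensor.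
pose b := @GRing.isLinear.Build _ _ _ _ a la.
pose al : {linear H -> H} := HB.pack a b.
rewrite -[a]/(al : H -> H) linearZ /=.
by congr (_%:R *: _); rewrite -(inj_eq (mulgI g)) mulVKg.
Qed.

Definition A_free (a0 : H -> H) (a : 'I_(d + d) -> H -> H)
    (f : F -> H) : F -> H :=
  fun h => tens_lambda a0 1%g f h
         + \sum_(i < d + d) tens_lambda (a i) (fgen2 i) f h.

End FreeSide.

Section FiniteSide.
Variables (d N : nat).

Definition tens_mx (a : H -> H) (M : 'M[R[i]]_N) (f : 'I_N -> H) : 'I_N -> H :=
  fun x => \sum_(y < N) M x y *: a (f y).

Lemma tens_mx_elem a M v (xi : 'cV[R[i]]_N) : linear a ->
  tens_mx a M (elem_tensor v (fun y => xi y 0)) =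
  elem_tensor (a v) (fun y => (M *m xi) y 0).
Proof.
move=> la; apply/funext => t; rewrite /tens_mx /elem_tensor.
pose b := @GRing.isLinear.Build _ _ _ _ a la.
pose al : {linear H -> H} := HB.pack a b.
rewrite -[a]/(al : H -> H) mxE scaler_suml; apply: eq_bigr => y _.
by rewrite linearZ /= scalerA.
Qed.

End FiniteSide.
End Operators.

Section Schreier.
Variables (d N : nat) (sigma : 'I_d -> {perm 'I_N}).

(* the permutation matrix of s maps e_y to e_{s y} *)
Definition permutation_mx (R : realType) (s : {perm 'I_N}) : 'M[R[i]]_N :=
  \matrix_(x, y) (x == s y)%:R.

Definition Umx (R : realType) (i : 'I_(d + d)) : 'M[R[i]]_N :=
  match fintype.split i with
  | inl j => permutation_mx R (sigma j)
  | inr j => map_mx Num.conj (permutation_mx R (sigma j))^T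
  end.

(* multiplicity of the edge xy: the matrix sum_i U_i, see schreierE *)
Definition schreier (x y : 'I_N) : nat :=
  #|[pred j | x == sigma j y]| + #|[pred j | y == sigma j x]|.

Lemma schreierE (R : realType) :
  \sum_(i < d + d) Umx R i = \matrix_(x, y) (schreier x y)%:R.
Proof.
apply/matrixP => x y; rewrite summxE mxE big_split_ord natrD /=.
congr (_ + _); rewrite -sum1_card natr_sum [RHS]big_mkcond /=;
  apply: eq_bigr => j _; rewrite /Umx.
- by rewrite (unsplitK (inl j)) mxE inE; case: eqP.
- by rewrite (unsplitK (inr j)) !mxE inE rmorph_nat; case: eqP.
Qed.

End Schreier.

(* Undirected multigraphs on 'I_N, given by their edge multiplicities *)
Section Multigraph.
Variables (N : nat) (G : 'I_N -> 'I_N -> nat).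

Definition adjacent : rel 'I_N := fun x y => (0 < G x y)%N.

(* vertices at graph distance at most h from x *)
Definition gball (x : 'I_N) (h : nat) : set 'I_N :=
  [set y | exists s : seq 'I_N,
     [/\ path adjacent x s, last x s = y & (size s <= h)%N]].

(* Cycles of length 1 are loops, cycles of length 2 are pairs of parallel
   edges. *)
Definition mcycle (c : seq 'I_N) : bool :=
  [&& (0 < size c)%N, ucycleb adjacent c
    & if c is [:: u; v] then (1 < G u v)%N else true].

(* the subgraph spanned by the vertices in B has no cycle *)
Definition acyclic_on (B : set 'I_N) : Prop :=
  forall c, (forall u, u \in c -> B u) -> ~~ mcycle c.

End Multigraph.

Section FiniteModel.
Variables (R : realType) (H : completeNormedModType R[i]) (d N : nat).

Definition A_perm (sigma : 'I_d -> {perm 'I_N}) (a0 : H -> H)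
    (a : 'I_(d + d) -> H -> H) (f : 'I_N -> H) : 'I_N -> H :=
  fun x => tens_mx a0 1%:M f x
         + \sum_(i < d + d) tens_mx (a i) (Umx sigma R i) f x.

Definition one_vec : 'cV[R[i]]_N := const_mx (Num.sqrt (N%:R : R))^-1%:C.

Definition Pi_op : ('I_N -> H) -> ('I_N -> H) :=
  tens_mx idfun (1%:M - one_vec *m map_mx Num.conj one_vec^T).

End FiniteModel.
Arguments Pi_op {R} H N.

(* Main.v *)
From HB Require Import structures.
Require Import Defs.
From mathcomp Require Import all_boot all_order all_fingroup all_algebra complex.
From mathcomp Require Import all_classical all_reals all_analysis.
From mathcomp Require Import zify ring lra.
Import Order.TTheory GRing.Theory Num.Theory.
Import numFieldNormedType.Exports.

Set Implicit Arguments.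
Unset Strict Implicit.
Unset Printing Implicit Defensive.

Local Open Scope classical_set_scope.
Local Open Scope ring_scope.
Local Open Scope complex_scope.

(* A vector f on the free group can be cut into pieces living in balls of
   radius p - 1 without losing more than a factor (p - 1)/(p + 1) of the norm
   of A f. To every g attach the first p vertices of the path from g to a
   fixed end of the tree (its ancestors), and for every vertex k let f_k be
   the restriction of f to those g having k among their ancestors. Neighbours
   in the tree share exactly p - 1 of their p ancestors, so that the sum of
   (A f_k)(g) over the ancestors k of g is (p - 1) (A f)(g) + a_0 (f g);
   Cauchy-Schwarz on these p + 1 terms bounds |A f| by (p + 1)/(p - 1) times the norm
   of A on vectors supported in a ball of radius p - 1. Such a vector is
   transplanted to the Schreier graph, with a plus sign around x and a minus
   sign around y; this is orthogonal to the constants, and no norm is lost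
   since the balls of radius p around x and y are disjoint trees. The
   resulting rate 1 - 2/(p + 1) is stronger than the one claimed. *)

(** * The Schreier graph is covered by the tree *)

Section ReducedWords.
Variable d : nat.
Implicit Types (l m : 'I_d * bool) (u v w : seq ('I_d * bool)).

Lemma reduced_cons l w : reduced (l :: w) -> reduced w.
Proof. exact: path_sorted. Qed.

Lemma push_reduced l w : reduced (l :: w) -> push l w = l :: w.
Proof. by case: w => //= m w /andP[/negPf ->]. Qed.

Lemma push_linv l w : push (linv l) (l :: w) = w.
Proof. by rewrite /= linvK eqxx. Qed.

Lemma reduced_drop j w : reduced w -> reduced (drop j w).
Proof. by move=> rw; apply: drop_sorted. Qed.

Lemma pushP l w : push l w = l :: w \/ w = linv l :: push l w.
Proof. by case: w => [|m w] /=; [left | case: eqP => [->|]; [right | left]]. Qed.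

Lemma size_push l w : (size (push l w) <= (size w).+1)%N.
Proof. by case: (pushP l w) => [->|{2}->] //=; rewrite ltnW // ltnW. Qed.

Lemma leq_size_push l w : (size w <= (size (push l w)).+1)%N.
Proof. by case: (pushP l w) => [->|{1}->] //=; rewrite leqW // leqW. Qed.

Definition word_adj u v := [exists l, v == push l u].

Lemma word_adjC u v : reduced u -> word_adj u v -> word_adj v u.
Proof.
by move=> ru /existsP[l /eqP ->]; apply/existsP; exists (linv l); rewrite pushK.
Qed.

(* The path runs from [u] down to the empty word and up again to [v], hence it
   stays in the ball. *)
Lemma word_adj_connected n u v : reduced u -> reduced v ->
    (size u <= n)%N -> (size v <= n)%N ->
  exists s, [/\ path word_adj u s, last u s = v, uniq (u :: s) &
    forall w, w \in u :: s -> reduced w /\ (size w <= n)%N].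
Proof.
have down w : reduced w -> (size w <= n)%N -> exists s,
    [/\ path word_adj w s, last w s = [::] &
     forall t, t \in w :: s -> reduced t /\ (size t <= n)%N].
  elim: w => [|l w IH] rw sw.
    by exists [::]; split=> // t; rewrite inE => /eqP ->.
  have [s [ps ls Ps]] := IH (reduced_cons rw) (ltnW sw).
  exists (w :: s); split=> //=.
    by rewrite ps andbT; apply/existsP; exists (linv l); rewrite push_linv.
  by move=> t; rewrite inE => /orP[/eqP ->|/Ps].
move=> ru rv su sv; have [s [ps ls Ps]] := down u ru su.
have [t [pt lt Pt]] := down v rv sv.
have [t' [pt' lt' Pt']] : exists t', [/\ path word_adj [::] t', last [::] t' = v
    & forall w, w \in [::] :: t' -> w \in v :: t].
  exists (rev (belast v t)); split.
  - rewrite -lt rev_path.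
    apply: (@sub_in_path _ (@reduced d) _ _ _ _ _ _ pt) => [a b ra _|].
      exact: word_adjC.
    by apply/allP => w /Pt[].
  - by case: (t) lt => //= a t0 _; rewrite rev_cons last_rcons.
  - by move=> w; rewrite -lt -rev_rcons mem_rev -lastI.
have pp : path word_adj u (s ++ t') by rewrite cat_path ps ls.
have lp : last u (s ++ t') = v by rewrite last_cat ls.
case/shortenP: pp lp => s' ps' us' sub lp; exists s'; split=> // w.
rewrite inE => /orP[/eqP ->|/sub]; first by split.
rewrite mem_cat => /orP[ws|wt]; first by apply: Ps; rewrite inE ws orbT.
by apply/Pt/Pt'; rewrite inE wt orbT.
Qed.

End ReducedWords.

Section SchreierCovering.
Variables (d N : nat) (sigma : 'I_d -> {perm 'I_N}).
Implicit Types (l : 'I_d * bool) (u v w : seq ('I_d * bool)) (x y z : 'I_N).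

Local Notation G := (schreier sigma).
Local Notation adj := (Defs.adjacent G).

Definition letter_act l z := if l.2 then (sigma l.1)^-1%g z else sigma l.1 z.

(** For fixed [x] this is the covering map from the tree of reduced words to the component of [x],
    with the empty word sent to [x]. *)
Definition word_act x w := foldr letter_act x w.

Lemma letter_actK l : cancel (letter_act l) (letter_act (linv l)).
Proof. by case: l => j [] z; rewrite /letter_act /= ?permK ?permKV. Qed.

Lemma word_act_push x l w :
  word_act x (push l w) = letter_act l (word_act x w).
Proof.
case: w => //= m w; case: eqP => [->|//] /=.
by rewrite -{1}[l]linvK letter_actK.
Qed.

Lemma adjacent_letter_act l z : adj z (letter_act l z).
Proof.
rewrite /Defs.adjacent /schreier addn_gt0; apply/orP.
case: l => j [] /=; rewrite /letter_act /=; [left|right];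
  by apply/card_gt0P; exists j; rewrite inE ?permKV.
Qed.

Lemma adjacentC : symmetric adj.
Proof. by move=> x y; rewrite /Defs.adjacent /schreier addnC. Qed.

Lemma word_adj_act x u v :
  word_adj u v -> adj (word_act x u) (word_act x v).
Proof. by case/existsP=> l /eqP ->; rewrite word_act_push adjacent_letter_act. Qed.

(** The first summand of [schreier] counts the inverse letters from [z] to its image, the second the
    positive ones, so two distinct letters contribute two units of multiplicity. *)
Lemma schreier_gt1 l l' z : l != l' -> letter_act l z = letter_act l' z ->
  (1 < G z (letter_act l z))%N.
Proof.
have two (P : pred 'I_d) j k : j != k -> P j -> P k -> (1 < #|P|)%N.
  by move=> jk Pj Pk; apply/card_gt1P; exists j, k; split.
have one (P : pred 'I_d) j : P j -> (0 < #|P|)%N.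
  by move=> Pj; apply/card_gt0P; exists j.
case: l l' => [j b] [k b']; rewrite /schreier /letter_act /=.
case: b; case: b' => ne /= e.
- apply: leq_trans (leq_addr _ _); apply: (two _ j k); rewrite ?inE ?permKV //.
    by apply: contraNneq ne => ->.
  by rewrite e permKV.
- apply: (@leq_add 1 1); [apply: (one _ j) | apply: (one _ k)];
    by rewrite inE ?permKV // e.
- apply: (@leq_add 1 1); [apply: (one _ k) | apply: (one _ j)];
    by rewrite inE // e permKV.
- apply: leq_trans (leq_addl _ _); apply: (two _ j k); rewrite ?inE //.
    by apply: contraNneq ne => ->.
  by rewrite e.
Qed.

Lemma word_act_gball x w n : (size w <= n)%N -> gball G x n (word_act x w).
Proof.
move=> sw; have [s [ps ls ss]] : exists s, [/\ path adj x s,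
    last x s = word_act x w & size s = size w].
  elim: w {sw} => [|l w [s [ps ls ss]]]; first by exists [::].
  exists (rcons s (letter_act l (word_act x w))).
  by rewrite rcons_path ps ls last_rcons size_rcons ss adjacent_letter_act.
by exists s; rewrite ss.
Qed.

Lemma word_act_path x u s :
  path (@word_adj d) u s -> path adj (word_act x u) (map (word_act x) s).
Proof. by elim: s u => //= v s IH u /andP[uv /IH ->]; rewrite word_adj_act. Qed.

(* By induction on the radius: if [word_act x] is injective on words of length
   at most [n], a coincidence in length [n + 1] closes a path of the tree into a
   simple cycle. *)
Lemma word_act_inj x p u v : acyclic_on G (gball G x p) ->
  reduced u -> reduced v -> (size u <= p)%N -> (size v <= p)%N ->
  word_act x u = word_act x v -> u = v.
Proof.
move=> acyc.
suff inj n : (n <= p)%N -> forall u v, reduced u -> reduced v ->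
    (size u <= n)%N -> (size v <= n)%N -> word_act x u = word_act x v -> u = v.
  by move=> ru rv su sv; apply: (inj p).
elim: n => [_ [|//] [|//] //|n IH np {}u {}v ru rv].
have {}IH := IH (ltnW np).
have inball w : (size w <= n.+1)%N -> gball G x p (word_act x w).
  by move=> sw; apply: word_act_gball; exact: leq_trans np.
(* A coincidence with a word of length at most [n]: the tree path from [u'] to [w] maps injectively,
   and the edge given by [a] closes it. *)
have short a u' w : reduced (a :: u') -> reduced w -> (size u' <= n)%N ->
    (size w <= n)%N -> word_act x (a :: u') = word_act x w -> a :: u' = w.
  move=> rau rw su' sw e; apply/eqP/negPn/negP => ne.
  have [s [ps ls us Ps]] :=
    word_adj_connected (reduced_cons rau) rw su' sw.
  have /negP[] : ~~ mcycle G (map (word_act x) (u' :: s)).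
    by apply: acyc => z /mapP[t /Ps[_ st] ->]; apply/inball/ltnW.
  rewrite /mcycle /ucycleb; apply/and3P; split=> //.
    apply/andP; split; last first.
      by rewrite map_inj_in_uniq // => t t' /Ps[rt st] /Ps[rt' st']; apply: IH.
    rewrite /= rcons_path word_act_path // last_map ls -e /= adjacentC.
    exact: adjacent_letter_act.
  (* A cycle of length two requires parallel edges: here [w] is a neighbour of [u'] through a letter
     [b] other than [a]. *)
  case: s ps ls {us Ps} => [//|w1 [|//]] /=.
  rewrite andbT => /existsP[b /eqP ->] e1.
  move: ne e; rewrite -e1 word_act_push -[word_act x (a :: u')]/(letter_act a _).
  move=> ne e; rewrite -e; apply: (schreier_gt1 (l' := b)) => //.
  by apply: contraNneq ne => <-; rewrite push_reduced.
rewrite leq_eqVlt => /orP[/eqP su|su]; last first.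
  rewrite leq_eqVlt => /orP[/eqP sv|sv]; last exact: IH.
  case: v rv sv => //= b v rv [sv] e; symmetry.
  by apply: short => //; rewrite ?sv.
rewrite leq_eqVlt => /orP[/eqP sv|sv]; last first.
  case: u ru su => //= b u ru [su] e.
  by apply: short => //; rewrite ?su.
(* Both words have length [n + 1]: by [short] their common image avoids the image of the path
   between the tails, so it closes that path into a simple cycle. *)
case: u ru su => //= a u ru [su]; case: v rv sv => //= b v rv [sv] e.
apply/eqP/negPn/negP => ne.
have [s [ps ls us Ps]] := word_adj_connected (reduced_cons ru) (reduced_cons rv)
  (eq_leq su) (eq_leq sv).
have new t : t \in u :: s -> letter_act a (word_act x u) <> word_act x t.
  move=> /Ps[rt st] /(short a u t ru rt (eq_leq su) st) e'.
  by move: st; rewrite -e' /= su ltnn.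
have /negP[] :
    ~~ mcycle G (letter_act a (word_act x u) :: map (word_act x) (u :: s)).
  apply: acyc => z; rewrite inE => /orP[/eqP ->|/mapP[t /Ps[_ st] ->]].
    by apply: (inball (a :: u)); rewrite /= su.
  by apply/inball/ltnW.
rewrite /mcycle /ucycleb; apply/and3P; split=> //.
  apply/andP; split.
    rewrite /= adjacentC adjacent_letter_act /= rcons_path word_act_path //.
    by rewrite last_map ls e adjacent_letter_act.
  rewrite cons_uniq map_inj_in_uniq ?us ?andbT.
    by apply/mapP => -[t /new].
  by move=> t t' /Ps[rt st] /Ps[rt' st']; apply: IH.
(* Equal tails give a cycle of length two, whose edges are the distinct letters [a] and [b]. *)
case: s ps ls {us Ps new} => //= _ uv; subst v.
rewrite /schreier addnC; apply: (schreier_gt1 (l' := b)) => //.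
by apply: contraNneq ne => ->.
Qed.

End SchreierCovering.

(** * Square norms and operator norms *)

Section SquareNorms.
Variables (R : realType) (H : completeNormedModType R[i]).
Implicit Types (u v : H).

Definition hnorm v : R := complex.Re `|v|.

Lemma hnormE v : `|v| = (hnorm v)%:C.
Proof. by rewrite /hnorm RRe_real // ger0_real. Qed.

Lemma hnorm_ge0 v : 0 <= hnorm v.
Proof. by rewrite -lecR -hnormE; exact: normr_ge0. Qed.

Lemma hnorm0 : hnorm 0 = 0.
Proof. by rewrite /hnorm normr0. Qed.

Lemma hnorm0_eq0 v : hnorm v = 0 -> v = 0.
Proof. by move=> v0; apply/normr0_eq0; rewrite hnormE v0. Qed.

Lemma hnormN v : hnorm (- v) = hnorm v.
Proof. by rewrite /hnorm normrN. Qed.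

Lemma hnormD u v : hnorm (u + v) <= hnorm u + hnorm v.
Proof. by rewrite -lecR rmorphD /= -!hnormE; exact: ler_normD. Qed.

Lemma hnormZ (k : R) v : hnorm (k%:C *: v) = `|k| * hnorm v.
Proof.
apply: complexI; rewrite rmorphM /= -!hnormE normrZ; congr (_ * _).
by rewrite normc_def /= expr0n addr0 sqrtr_sqr.
Qed.

Lemma hnormMn v n : hnorm (v *+ n) = hnorm v *+ n.
Proof.
rewrite -scaler_nat -[n%:R](rmorph_nat (real_complex R)) hnormZ normr_nat.
by rewrite mulr_natl.
Qed.

Lemma hnorm_sum_sqr n (w : nat -> H) :
  hnorm (\sum_(j < n) w j) ^+ 2 <= n%:R * \sum_(j < n) hnorm (w j) ^+ 2.
Proof.
suff: (\sum_(j < n) hnorm (w j)) ^+ 2 <= n%:R * \sum_(j < n) hnorm (w j) ^+ 2.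
  apply: le_trans; rewrite ler_sqr ?nnegrE ?hnorm_ge0 ?sumr_ge0//; last first.
    by move=> i _; exact: hnorm_ge0.
  apply: (big_ind2 (fun (v : H) (r : R) => hnorm v <= r)); rewrite ?hnorm0//.
  by move=> a b c e ab ce; apply: le_trans (hnormD _ _) (lerD ab ce).
elim: n => [|n IH]; first by rewrite !big_ord0 expr0n mul0r.
case: n IH => [|n] IH; first by rewrite !big_ord1 mul1r.
rewrite !(big_ord_recr n.+1) /=.
set S := \sum_(i < _) _ in IH *; set Q := \sum_(i < _) _ in IH *.
set t := hnorm _.
rewrite -(ler_pM2l (ltr0Sn R n)) -[n.+2]addn1 natrD.
have n0 : 0 < n.+1%:R :> R by [].
move: IH; set m : R := n.+1%:R in n0 *; move=> IH.
(* After multiplication by [m], the induction hypothesis leaves a gap of at least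
   [(S - m * t) ^+ 2]. *)
have := sqr_ge0 (S - m * t); nra.
Qed.

Definition sqnorm (S : choiceType) (f : S -> H) : \bar R :=
  \esum_(s in [set: S]) (hnorm (f s) ^+ 2)%:E.

Lemma l2normE (S : choiceType) (f : S -> H) : l2norm f = sqrte (sqnorm f).
Proof. by []. Qed.

Lemma sqnorm_ge0 (S : choiceType) (f : S -> H) : (0 <= sqnorm f)%E.
Proof. by apply: esum_ge0 => s _; rewrite lee_fin sqr_ge0. Qed.

Lemma sum_seq_le_esum (S : choiceType) (r : seq S) (b : S -> \bar R) :
  uniq r -> (forall s, (0 <= b s)%E) ->
  (\sum_(s <- r) b s <= \esum_(s in [set: S]) b s)%E.
Proof.
move=> ur b0; apply: esum_ge; exists [set` r]; first by split.
by rewrite -fsbig_seq.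
Qed.

Lemma esum_le_seq (S : choiceType) (r : seq S) (b : S -> \bar R) :
  uniq r -> (forall s, s \notin r -> b s = 0) -> (forall s, (0 <= b s)%E) ->
  (\esum_(s in [set: S]) b s <= \sum_(s <- r) b s)%E.
Proof.
move=> ur br b0; rewrite fsbig_seq // -esum_fset //.
rewrite [leRHS]esum_mkcond; apply: le_esum => s _.
case: ifPn => // ns; rewrite br //.
by apply: contraNN ns; rewrite inE.
Qed.

Lemma esumZl_le (S : choiceType) (c : R) (b : S -> \bar R) : 0 <= c ->
  (forall s, (0 <= b s)%E) ->
  (\esum_(s in [set: S]) (c%:E * b s) <= c%:E * \esum_(s in [set: S]) b s)%E.
Proof.
move=> c0 b0; apply: ge_ereal_sup => _ [X XS] <-.
rewrite -ge0_mule_fsumr //; apply: lee_wpmul2l; first by rewrite lee_fin.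
by apply: esum_ge; exists X.
Qed.

Lemma sqnorm_fin (S : finType) (f : S -> H) :
  sqnorm f = (\sum_s hnorm (f s) ^+ 2)%:E.
Proof.
have nn s : (0 <= (hnorm (f s) ^+ 2)%:E)%E by rewrite lee_fin sqr_ge0.
rewrite -sumEFin; apply/eqP; rewrite eq_le; apply/andP; split.
  by apply: esum_le_seq => // [|s]; rewrite ?index_enum_uniq ?mem_index_enum.
by apply: sum_seq_le_esum; rewrite ?index_enum_uniq.
Qed.

Lemma opnorm_ge0 (S : choiceType) (T : (S -> H) -> S -> H) : (0 <= opnorm T)%E.
Proof.
apply: (@le_trans _ _ (l2norm (T (fun=> 0)))); first exact: sqrte_ge0.
apply: ereal_sup_ubound; exists (fun=> 0) => //=;
  rewrite l2normE [sqnorm _]esum1 ?sqrte0 ?lee01 //.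
by move=> s _; rewrite hnorm0 expr0n.
Qed.

Lemma opnorm_le (S : choiceType) (T : (S -> H) -> S -> H) (C : R) : 0 <= C ->
  (forall f, (sqnorm f <= 1)%E -> (sqnorm (T f) <= (C ^+ 2)%:E)%E) ->
  (opnorm T <= C%:E)%E.
Proof.
move=> C0 le; apply: ge_ereal_sup => _ [f /= f1 <-].
have sq1 : sqrte 1%:E = 1%:E :> \bar R by rewrite /= sqrtr1.
have sqC : sqrte (C ^+ 2)%:E = C%:E by rewrite /= sqrtr_sqr ger0_norm.
rewrite l2normE -sqC lee_sqrt ?lee_fin ?sqr_ge0 //; apply: le.
by move: f1; rewrite l2normE -[X in (_ <= X)%E]sq1 lee_sqrt // lee_fin ler01.
Qed.

(** [opnorm] only tests vectors of norm at most one; dividing by the norm of [f] reaches all the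
    others. *)
Lemma sqnorm_le_opnorm (S : finType) (T : (S -> H) -> S -> H) (M : R) :
  (forall (k : R) f s, T (fun s => k%:C *: f s) s = k%:C *: T f s) ->
  opnorm T = M%:E ->
  forall f, \sum_s hnorm (T f s) ^+ 2 <= M ^+ 2 * \sum_s hnorm (f s) ^+ 2.
Proof.
move=> TZ TM f.
have M0 : 0 <= M by rewrite -lee_fin -TM opnorm_ge0.
set r := \sum_s hnorm (f s) ^+ 2.
have r0 : 0 <= r by apply: sumr_ge0 => s _; exact: sqr_ge0.
have [r_eq0|r_gt0] := leP r 0.
  have f0 s : f s = 0.
    have /eqP : r = 0 by apply/eqP; rewrite eq_le r_eq0.
    rewrite psumr_eq0 => [/allP/(_ s)|? _]; last exact: sqr_ge0.
    by rewrite mem_index_enum sqrf_eq0 => /(_ isT)/eqP/hnorm0_eq0.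
  have fE : f = (fun s => 0%:C *: f s) by apply/funext => s; rewrite f0 scaler0.
  rewrite big1 => [|s _]; first by rewrite mulr_ge0 ?sqr_ge0.
  by rewrite fE TZ scale0r hnorm0 expr0n.
have sr0 : 0 < Num.sqrt r by rewrite sqrtr_gt0.
set k := (Num.sqrt r)^-1.
have sumZ (g : S -> H) :
    \sum_s hnorm (k%:C *: g s) ^+ 2 = r^-1 * \sum_s hnorm (g s) ^+ 2.
  rewrite mulr_sumr; apply: eq_bigr => s _.
  by rewrite hnormZ exprMn -normrX ger0_norm ?sqr_ge0 // exprVn sqr_sqrtr.
have : (l2norm (T (fun s => k%:C *: f s)) <= M%:E)%E.
  rewrite -TM; apply: ereal_sup_ubound; exists (fun s => k%:C *: f s) => //=.
  by rewrite l2normE sqnorm_fin sumZ -/r mulVf ?gt_eqF //= sqrtr1.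
rewrite (_ : T _ = fun s => k%:C *: T f s); last by apply/funext => s; exact: TZ.
rewrite l2normE sqnorm_fin sumZ /= lee_fin => le.
rewrite -(ler_pM2l (x := r^-1)) ?invr_gt0 // mulrCA mulVf ?gt_eqF // mulr1.
rewrite -ler_sqrt ?exprn_ge0 // sqrtr_sqr ger0_norm //.
Qed.

End SquareNorms.

(** * Localization on the free group *)

Section Ancestors.
Variable d : nat.
Local Notation F := (free_group d).
Implicit Types (g h : F) (u w : seq ('I_d * bool)).

Lemma word_mul_cat u w : reduced (u ++ w) -> word_mul u w = u ++ w.
Proof.
elim: u => //= l u IH r.
by rewrite -[LHS]/(push l (word_mul u w)) IH ?push_reduced // (reduced_cons r).
Qed.

Lemma fball_seq n : exists2 B : seq F, uniq B &
  forall g, (g \in B) = (size (val g) <= n)%N.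
Proof.
pose words k : seq (seq ('I_d * bool)) :=
  map val (enum {: k.-tuple ('I_d * bool)}).
pose W := flatten (map words (iota 0 n.+1)).
exists (undup (pmap insub W)); first exact: undup_uniq.
move=> g; rewrite mem_undup mem_pmap_sub; apply/flatten_mapP/idP.
  by case=> k; rewrite mem_iota /= ltnS => kn /mapP[t _ ->]; rewrite size_tuple.
move=> gn; exists (size (val g)); first by rewrite mem_iota.
by apply/mapP; exists (in_tuple (val g)); rewrite ?mem_enum.
Qed.

(* The [j]-th vertex of the path that goes from [g] to the root [1], and then
   along an added ray whose [m]-th vertex is [(1, m)]. *)
Definition anc g j : F * nat :=
  (exist _ (drop j (val g)) (reduced_drop j (valP g)), (j - size (val g))%N).

Definition ancs q g := [seq anc g j | j <- iota 0 q].

Lemma anc_inj g : injective (anc g).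
Proof.
move=> i j [/(congr1 size)]; rewrite !size_drop; move: (size _) => n; lia.
Qed.

Lemma mem_ancs q g j : (anc g j \in ancs q g) = (j < q)%N.
Proof. by rewrite mem_map ?mem_iota //; exact: anc_inj. Qed.

Lemma ancs_uniq q g : uniq (ancs q g).
Proof. by rewrite map_inj_uniq ?iota_uniq //; exact: anc_inj. Qed.

Lemma anc_cons l g h j : val h = l :: val g -> anc h j.+1 = anc g j.
Proof. by move=> e; congr pair; [apply: val_inj|]; rewrite /= e. Qed.

(** Of two neighbours one is the parent of the other on the way to the end, so their ancestor
    sequences agree up to a shift. *)
Lemma anc_push l g h : val h = push l (val g) ->
  (forall j, anc h j.+1 = anc g j) \/ (forall j, anc g j.+1 = anc h j).
Proof.
move=> e; have [p|p] := pushP l (val g); [left|right] => j.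
  by apply: (anc_cons (l := l)); rewrite e p.
by apply: (anc_cons (l := linv l)); rewrite e; exact: p.
Qed.

(** Exactly one ancestor of [g] is not shared: the last one if [h] is the child, [anc g 0] if [g] is
    the child. *)
Lemma sum_ancs_overlap (V : zmodType) (v : V) q l g h :
  val h = push l (val g) ->
  \sum_(j < q.+1) (if anc g j \in ancs q.+1 h then v else 0) = v *+ q.
Proof.
have const (P : 'I_q -> bool) : (forall j, P j) ->
    \sum_(j < q) (if P j then v else 0) = v *+ q.
  by move=> PT; under eq_bigr do rewrite PT; rewrite sumr_const card_ord.
case/anc_push=> e.
  rewrite big_ord_recr /= -e mem_ancs ltnn addr0 const // => j.
  by rewrite -e mem_ancs ltnS ltn_ord.
rewrite big_ord_recl /= const => [|j]; last first.
  by rewrite -[bump 0 j]/j.+1 e mem_ancs ltnS ltnW ?ltn_ord.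
case: ifP => [/mapP[j _]|_]; last by rewrite add0r.
by rewrite -e => /anc_inj.
Qed.

(** The first component of an ancestor is a suffix of the word, and [g] is the removed prefix, of at
    most [q] letters. Pieces can thus be translated into the ball of radius [q] around the
    identity. *)
Lemma anc_translate_small q g (k : F * nat) :
  k \in ancs q.+1 (g * k.1)%g -> (size (val g) <= q)%N.
Proof.
set h := (g * k.1)%g => /mapP[j]; rewrite mem_iota /= ltnS => jq ek.
have rt : reduced (take j (val h)) := take_sorted j (valP h).
pose t : F := exist _ (take j (val h)) rt.
have th : (t * k.1)%g = h.
  apply: val_inj; rewrite ek /= word_mul_cat cat_take_drop //; exact: (valP h).
have -> : g = t by apply: (mulIg k.1); rewrite th.
by rewrite /= size_take_min (leq_trans (geq_minl _ _)).
Qed.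

End Ancestors.

Lemma esum_swap (R : realType) (S T : choiceType) (b : S -> T -> \bar R) :
  (forall s t, (0 <= b s t)%E) ->
  (\esum_(s in [set: S]) \esum_(t in [set: T]) b s t =
   \esum_(t in [set: T]) \esum_(s in [set: S]) b s t)%E.
Proof.
move=> b0; rewrite !esum_esum //.
rewrite (@reindex_esum R _ _ ([set: T] `*`` fun=> [set: S]) _
  (fun k => (k.2, k.1))) //; split=> //.
- by move=> [? ?] [? ?] _ _ [-> ->].
- by move=> [s t] _; exists (t, s).
Qed.

Section FreeLocalization.
Variables (R : realType) (H : completeNormedModType R[i]) (d : nat).
Local Notation F := (free_group d).
Variables (a0 : {linear H -> H}) (a : 'I_(d + d) -> {linear H -> H}).
Local Notation A := (A_free a0 (fun i => a i : H -> H)).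

Definition letter (i : 'I_(d + d)) : 'I_d * bool :=
  match fintype.split i with inl j => (j, false) | inr j => (j, true) end.

Lemma val_fgen2V_mul i (g : F) :
  val ((fgen2 i)^-1 * g)%g = push (linv (letter i)) (val g).
Proof.
rewrite /fgen2 /letter; case: fintype.split => j //=.
Qed.

Lemma val_fgen2_mul i (g : F) : val (fgen2 i * g)%g = push (letter i) (val g).
Proof.
rewrite -[in RHS](mulKg (fgen2 i) g) val_fgen2V_mul -{1}[letter i]linvK pushK //.
exact: valP.
Qed.

Lemma A_freeE (f : F -> H) g :
  A f g = a0 (f g) + \sum_i a i (f ((fgen2 i)^-1 * g)%g).
Proof. by rewrite /A_free /tens_lambda invg1 mul1g. Qed.

(** The operator is built from left translations, which commute with right ones. *)
Lemma A_free_translate (f : F -> H) g h :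
  A (fun u => f (u * h)%g) g = A f (g * h)%g.
Proof. by rewrite !A_freeE; under eq_bigr do rewrite -mulgA. Qed.

Lemma sqnorm_translate (f : F -> H) h : sqnorm (fun u => f (u * h)%g) = sqnorm f.
Proof.
rewrite /sqnorm [RHS](@reindex_esum R _ _ [set: F] _ (fun u => (u * h)%g)) //.
split=> //; first by move=> u v _ _ /mulIg.
by move=> u _; exists (u * h^-1)%g; rewrite ?mulgKV.
Qed.

Definition piece q (f : F -> H) k g := if k \in ancs q g then f g else 0.

(** All [q + 1] ancestors of [g] keep the value at [g], but only [q] of them keep the value at a
    given neighbour; this leaves one surplus [a0] term. *)
Lemma sum_A_free_piece q (f : F -> H) g :
  \sum_(j < q.+1) A (piece q.+1 f (anc g j)) g = A f g *+ q + a0 (f g).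
Proof.
under eq_bigr do rewrite A_freeE.
rewrite big_split /= exchange_big /=.
have -> : \sum_(j < q.+1) a0 (piece q.+1 f (anc g j) g) = a0 (f g) *+ q.+1.
  rewrite -[in RHS](card_ord q.+1) -sumr_const; apply: eq_bigr => j _.
  by rewrite /piece mem_ancs ltn_ord.
rewrite A_freeE mulrnDl -sumrMnl mulrSr -!addrA; congr (_ + _).
rewrite addrC; congr (_ + _); apply: eq_bigr => i _.
rewrite -linear_sum -linearMn; congr (a i _).
exact: (sum_ancs_overlap _ _ (val_fgen2V_mul i g)).
Qed.

Variables (q : nat) (M : R).
(** To be supplied by [transplant], with [M] the norm of the finite model and [q + 1] the radius of
    the two balls. *)
Hypothesis local_bound : forall f : F -> H,
  (forall g, (q < size (val g))%N -> f g = 0) ->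
  (sqnorm (A f) <= (M ^+ 2)%:E * sqnorm f)%E.

(** Controls the surplus term: for the vector equal to [v] at the identity and zero elsewhere, [A f]
    takes the value [a0 v] at the identity. *)
Lemma local_coef0 v : hnorm (a0 v) ^+ 2 <= M ^+ 2 * hnorm v ^+ 2.
Proof.
pose f (g : F) : H := if g == 1%g then v else 0.
have f1 : f 1%g = v by rewrite /f eqxx.
have fN1 g : g != 1%g -> f g = 0 by rewrite /f => /negPf ->.
have Af1 : A f 1%g = a0 v.
  rewrite A_freeE f1 big1 ?addr0 // => i _; rewrite fN1 ?linear0 //.
  by apply/eqP => /(congr1 val); rewrite val_fgen2V_mul.
have fL g : (q < size (val g))%N -> f g = 0.
  by move=> qg; apply: fN1; apply: contraTneq qg => ->.
have /le_trans le := local_bound fL.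
rewrite -lee_fin; apply: (@le_trans _ _ (sqnorm (A f))).
  apply: le_trans (sum_seq_le_esum (r := [:: 1%g]) isT _) => [|g].
    by rewrite big_seq1 Af1.
  by rewrite lee_fin sqr_ge0.
apply: le; rewrite [leRHS]EFinM; apply: lee_wpmul2l.
  by rewrite lee_fin sqr_ge0.
apply: le_trans (esum_le_seq (r := [:: 1%g]) isT _ _) _ => [g|g|].
- by rewrite inE => /fN1 ->; rewrite hnorm0 expr0n.
- by rewrite lee_fin sqr_ge0.
- by rewrite big_seq1 f1.
Qed.

Lemma local_piece (f : F -> H) k :
  (sqnorm (A (piece q.+1 f k)) <= (M ^+ 2)%:E * sqnorm (piece q.+1 f k))%E.
Proof.
rewrite -(sqnorm_translate (piece _ _ _) k.1) -(sqnorm_translate (A _) k.1).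
under [X in sqnorm X]funext do rewrite -A_free_translate.
apply: local_bound => g; rewrite ltnNge /piece; case: ifP => //.
by move/anc_translate_small => ->.
Qed.

(** After exchanging the sums, each [f g] is counted once per ancestor of [g]. *)
Lemma sum_sqnorm_piece (f : F -> H) :
  (\esum_(k in [set: F * nat]) sqnorm (piece q.+1 f k) <= q.+1%:R%:E * sqnorm f)%E.
Proof.
have nn k g : (0 <= (hnorm (piece q.+1 f k g) ^+ 2)%:E)%E.
  by rewrite lee_fin sqr_ge0.
rewrite esum_swap //.
apply: (le_trans _ (esumZl_le _ _)) => // [|g]; last by rewrite lee_fin sqr_ge0.
apply: le_esum => g _.
apply: (le_trans (esum_le_seq (ancs_uniq q.+1 g) _ _)) => // [k /negPf kN|].
  by rewrite /piece kN hnorm0 expr0n.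
rewrite sumEFin -EFinM lee_fin big_map.
rewrite -[iota _ _]/(index_iota 0 q.+1) big_mkord.
under eq_bigr do rewrite /piece mem_ancs ltn_ord.
by rewrite sumr_const card_ord mulr_natl.
Qed.

Lemma A_free_pointwise (f : F -> H) g : (0 < q)%N ->
  hnorm (A f g) ^+ 2 <= q.+2%:R / q%:R ^+ 2 *
    (\sum_(j < q.+1) hnorm (A (piece q.+1 f (anc g j)) g) ^+ 2
     + hnorm (a0 (f g)) ^+ 2).
Proof.
move=> q0; rewrite mulrAC ler_pdivlMr ?exprn_gt0 ?ltr0n // -exprMn mulr_natr.
(* Cauchy-Schwarz is applied to [q + 2] terms; the last one, [- a0 (f g)], cancels the surplus. *)
pose w j := if (j < q.+1)%N then A (piece q.+1 f (anc g j)) g else - a0 (f g).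
have := hnorm_sum_sqr q.+2 w.
rewrite !(big_ord_recr q.+1) /= {2 4}/w ltnn hnormN.
have wE j : (j < q.+1)%N -> w j = A (piece q.+1 f (anc g j)) g by rewrite /w => ->.
under eq_bigr do rewrite wE //; under [in leRHS]eq_bigr do rewrite wE //.
by rewrite sum_A_free_piece addrK hnormMn.
Qed.

Lemma A_free_bound (f : F -> H) : (0 < q)%N ->
  (sqnorm (A f) <= ((q.+2%:R / q%:R * M) ^+ 2)%:E * sqnorm f)%E.
Proof.
move=> q0; set c : R := q.+2%:R / q%:R ^+ 2.
have c0 : 0 <= c by rewrite divr_ge0 ?exprn_ge0.
have nn (h : H) : (0 <= (hnorm h ^+ 2)%:E)%E by rewrite lee_fin sqr_ge0.
pose X g := (\sum_(j < q.+1) (hnorm (A (piece q.+1 f (anc g j)) g) ^+ 2)%:E)%E.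
have X0 g : (0 <= X g)%E by apply: sume_ge0.
have leX : (\esum_(g in [set: F]) X g <=
    ((M ^+ 2)%:E * (q.+1%:R%:E * sqnorm f)))%E.
  apply: (@le_trans _ _ (\esum_(g in [set: F]) \esum_(k in [set: F * nat])
      (hnorm (A (piece q.+1 f k) g) ^+ 2)%:E)).
    apply: le_esum => g _.
    apply: le_trans (sum_seq_le_esum (ancs_uniq q.+1 g) _) => //.
    rewrite big_map -[iota _ _]/(index_iota 0 q.+1) big_mkord //.
  rewrite -esum_swap //.
  apply: (@le_trans _ _ (\esum_(k in [set: F * nat])
      ((M ^+ 2)%:E * sqnorm (piece q.+1 f k))%E)).
    by apply: le_esum => k _; exact: local_piece.
  apply: le_trans (esumZl_le (sqr_ge0 M) _) _ => [k|].
    exact: sqnorm_ge0.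
  by apply: lee_wpmul2l; rewrite ?lee_fin ?sqr_ge0 //; exact: sum_sqnorm_piece.
have leY : (sqnorm (a0 \o f) <= (M ^+ 2)%:E * sqnorm f)%E.
  apply: le_trans (esumZl_le (sqr_ge0 M) _) => //.
  by apply: le_esum => g _; rewrite -EFinM lee_fin; exact: local_coef0.
apply: (@le_trans _ _ (\esum_(g in [set: F])
    (c%:E * (X g + (hnorm (a0 (f g)) ^+ 2)%:E))%E)).
  apply: le_esum => g _; rewrite /X sumEFin -EFinD -EFinM lee_fin.
  exact: A_free_pointwise.
apply: le_trans (esumZl_le c0 _) _ => [g|]; first exact: adde_ge0.
rewrite esumD //; apply: (@le_trans _ _ (c%:E *
    ((M ^+ 2)%:E * (q.+1%:R%:E * sqnorm f) + (M ^+ 2)%:E * sqnorm f)))%E.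
  by apply: lee_wpmul2l; rewrite ?lee_fin //; apply: leeD.
(* The pieces contribute the factor [q + 1] and the surplus term the factor [1]; with the [q + 2]
   contained in [c] this makes a square. *)
have -> : ((q.+2%:R / q%:R * M) ^+ 2 = c * (M ^+ 2 * (q.+1%:R + 1))).
  by rewrite natr1 /c !exprMn exprVn; ring.
have distr (b m n : R) (s : \bar R) : 0 <= n -> (0 <= s)%E ->
    (b%:E * (m%:E * (n%:E * s) + m%:E * s) = (b * (m * (n + 1)))%:E * s)%E.
  move=> n0 s0; rewrite !EFinM EFinD -!muleA ge0_muleDl ?lee_fin // mul1e.
  by rewrite [in RHS]muleDr // ge0_adde_def // inE ?mule_ge0 ?lee_fin.
by rewrite distr ?sqnorm_ge0.
Qed.

End FreeLocalization.

(** * Transplantation to the Schreier graph *)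

Section Transplant.
Variables (R : realType) (H : completeNormedModType R[i]) (d N : nat).
Variable sigma : 'I_d -> {perm 'I_N}.
Variables (a0 : {linear H -> H}) (a : 'I_(d + d) -> {linear H -> H}).
Local Notation F := (free_group d).
Local Notation A := (A_free a0 (fun i => a i : H -> H)).
Local Notation T := (A_perm sigma a0 (fun i => a i : H -> H)).

Lemma tens_mx_delta (b : H -> H) (P : 'M[R[i]]_N) (f : 'I_N -> H) x y :
  (forall z, P x z = (z == y)%:R) -> tens_mx b P f x = b (f y).
Proof.
move=> Px; rewrite /tens_mx (bigD1 y) //= Px eqxx scale1r big1 ?addr0 // => z.
by rewrite Px => /negPf ->; rewrite scale0r.
Qed.

(** The same shape as [A_freeE], with letters acting on vertices in place of left translations. *)
Lemma A_permE (f : 'I_N -> H) z :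
  T f z = a0 (f z)
        + \sum_i a i (f (letter_act sigma (linv (letter i)) z)).
Proof.
rewrite /A_perm (tens_mx_delta _ _ (y := z)); last first.
  by move=> y; rewrite mxE eq_sym.
congr (_ + _); apply: eq_bigr => i _; apply: tens_mx_delta => y.
rewrite /Umx /letter /letter_act; case: fintype.split => j /=.
  by rewrite mxE eq_sym -(inj_eq (@perm_inj _ (sigma j)^-1%g)) permK.
by rewrite !mxE rmorph_nat.
Qed.

(** The constant stays implicit because the formula is applied to a vector whose coordinates sum to
    zero. *)
Lemma Pi_opE (f : 'I_N -> H) : exists k : R[i],
  forall z, Pi_op H N f z = f z - k *: \sum_y f y.
Proof.
exists ((Num.sqrt (N%:R : R))^-1%:C * Num.conj (Num.sqrt (N%:R : R))^-1%:C) => z.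
rewrite /Pi_op /tens_mx scaler_sumr -sumrN.
rewrite -[X in _ = X + _](tens_mx_delta (P := 1%:M) idfun f (x := z));
  last first.
  by move=> y; rewrite mxE eq_sym.
rewrite /tens_mx -big_split; apply: eq_bigr => y _ /=.
by rewrite !mxE big_ord1 !mxE scalerBl.
Qed.

Lemma A_perm_Pi_homogeneous (k : R) (f : 'I_N -> H) z :
  (T \o Pi_op H N) (fun s => k%:C *: f s) z = k%:C *: (T \o Pi_op H N) f z.
Proof.
have PiZ y : Pi_op H N (fun s => k%:C *: f s) y = k%:C *: Pi_op H N f y.
  rewrite /Pi_op /tens_mx scaler_sumr; apply: eq_bigr => u _.
  by rewrite /= !scalerA mulrC.
rewrite /= !A_permE PiZ linearZ scalerDr scaler_sumr; congr (_ + _).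
by apply: eq_bigr => i _; rewrite PiZ linearZ.
Qed.

Variables (x y : 'I_N) (q : nat) (M : R).
Local Notation G := (schreier sigma).
Hypothesis balls_disjoint : gball G x q.+1 `&` gball G y q.+1 = set0.
Hypothesis acyc_x : acyclic_on G (gball G x q.+1).
Hypothesis acyc_y : acyclic_on G (gball G y q.+1).
Hypothesis opnormT : opnorm (T \o Pi_op H N) = M%:E.

Local Notation small g := (size (val g) <= q.+1)%N.

Definition plant (t : bool * F) : 'I_N :=
  word_act sigma (if t.1 then x else y) (val t.2).

(** For one root this is injectivity of the covering on acyclic balls; for two roots, disjointness
    of the balls. *)
Lemma plant_inj t u : small t.2 -> small u.2 -> plant t = plant u -> t = u.
Proof.
have sep (g h : F) : small g -> small h ->
    word_act sigma x (val g) <> word_act sigma y (val h).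
  move=> sg sh e; have :
      (gball G x q.+1 `&` gball G y q.+1) (word_act sigma x (val g)).
    by split; [|rewrite e]; exact: word_act_gball.
  by rewrite balls_disjoint.
case: t u => [[] g] [[] h]; rewrite /plant /= => sg sh e.
- by congr (_, _); apply/val_inj/(word_act_inj acyc_x); rewrite ?(valP g) ?(valP h).
- by case: (sep _ _ sg sh e).
- by case: (sep _ _ sh sg (esym e)).
- by congr (_, _); apply/val_inj/(word_act_inj acyc_y); rewrite ?(valP g) ?(valP h).
Qed.

(* [f] is planted at [x] and [-f] at [y], so that the sum of the coordinates
   vanishes. *)
Lemma transplant (f : F -> H) :
  (forall g, (q < size (val g))%N -> f g = 0) ->
  (sqnorm (A f) <= (M ^+ 2)%:E * sqnorm f)%E.
Proof.
move=> fL.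
(* [B] contains the support of [f], and [B'], one step larger, that of [A f]. *)
have [B uB memB] := fball_seq d q; have [B' uB' memB'] := fball_seq d q.+1.
pose signed (e : F -> H) (t : bool * F) : H := if t.1 then e t.2 else - e t.2.
pose pairs (D : seq F) := [seq (b, g) | b <- [:: true; false], g <- D].
have mem_pairs D t : (t \in pairs D) = (t.2 \in D).
  case: t => b g; apply/allpairsP/idP => [[[b' g'] /= [_ g'D [_ ->]]]//|/= gD].
  by exists (b, g); split; rewrite // !inE; case: b.
have uniq_pairs D : uniq D -> uniq (pairs D).
  by move=> uD; apply: allpairs_uniq => // [[? ?] [? ?]] _ _ [-> ->].
have sum_pairs (D : seq F) (e : F -> H) :
    \sum_(t <- pairs D) hnorm (signed e t) ^+ 2
    = (\sum_(g <- D) hnorm (e g) ^+ 2) *+ 2.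
  rewrite big_allpairs !big_cons big_nil /= addr0 mulr2n; congr (_ + _).
  by apply: eq_bigr => g _; rewrite hnormN.
pose psi z : H := \sum_(t <- pairs B | plant t == z) signed f t.
have BB' t : t \in pairs B -> small t.2 by rewrite mem_pairs memB; exact: leqW.
(* [t] is the only candidate preimage of [z]. It may lie outside [pairs B], and then both sides
   vanish. *)
have psi_plant t z : (forall u, u \in pairs B -> (plant u == z) = (u == t)) ->
    psi z = signed f t.
  move=> zt; rewrite /psi big_seq_cond.
  have [tB|tB] := boolP (t \in pairs B).
    rewrite (bigID (pred1 t)) /= [X in _ + X]big1 ?addr0 => [|u]; last first.
      by case/andP=> /andP[/zt ->] /eqP ->; rewrite eqxx.
    rewrite -big_filter.
    rewrite (perm_big [:: t]) ?big_seq1 //=.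
    apply: uniq_perm; rewrite ?filter_uniq ?uniq_pairs // => u.
    rewrite mem_filter inE; have [->|_] := eqVneq u t.
      by rewrite tB zt // eqxx.
    by rewrite andbF.
  rewrite big1 => [|u /andP[uB1]]; last first.
    by rewrite (zt _ uB1) => /eqP ut; move: tB; rewrite -ut uB1.
  rewrite /signed fL ?oppr0; first by case: (t.1).
  by move: tB; rewrite mem_pairs memB -ltnNge.
have sum_psi : \sum_z psi z = 0.
  rewrite /psi (exchange_big_dep predT) //=.
  rewrite (eq_bigr (signed f)) => [|t _]; last first.
    by rewrite (big_pred1 (plant t)) // => z; rewrite eq_sym.
  rewrite big_allpairs !big_cons big_nil /= addr0 /signed /= sumrN.
  exact: subrr.
have norm_psi : \sum_z hnorm (psi z) ^+ 2
    <= (\sum_(g <- B) hnorm (f g) ^+ 2) *+ 2.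
  rewrite -sum_pairs.
  have -> : \sum_(t <- pairs B) hnorm (signed f t) ^+ 2 =
      \sum_z \sum_(t <- pairs B | plant t == z) hnorm (signed f t) ^+ 2.
    rewrite (exchange_big_dep predT) //=; apply: eq_bigr => t _.
    by rewrite (big_pred1 (plant t)) // => z; rewrite eq_sym.
  apply: ler_sum => z _.
  have [/hasP[t tB /eqP tz]|zN] := boolP (has (fun t => plant t == z) (pairs B)).
    rewrite (psi_plant t) => [|u uB1]; last first.
      by rewrite -tz; apply/eqP/eqP => [/(plant_inj (BB' _ uB1) (BB' _ tB))|->].
    rewrite [leRHS]big_mkcond (big_rem t) //= tz eqxx lerDl sumr_ge0 // => u _.
    by case: ifP; rewrite ?sqr_ge0.
  rewrite /psi big_hasC // hnorm0 expr0n sumr_ge0 // => u _; exact: sqr_ge0.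
have signedA t : a0 (signed f t)
    + \sum_i a i (signed f (t.1, ((fgen2 i)^-1 * t.2)%g)) = signed (A f) t.
  case: t => [[] g]; rewrite /signed /= A_freeE // linearN opprD -sumrN.
  by congr (_ + _); apply: eq_bigr => i _; rewrite linearN.
have T_psi t : small t.2 -> T (Pi_op H N psi) (plant t) = signed (A f) t.
  move=> st; have [k PiE] := Pi_opE psi.
  have {k}PiE z : Pi_op H N psi z = psi z by rewrite PiE sum_psi scaler0 subr0.
  rewrite A_permE !PiE -signedA; congr (_ + _).
    congr (a0 _); apply: psi_plant => u uB1.
    by apply/eqP/eqP => [/(plant_inj (BB' _ uB1) st)|->].
  apply: eq_bigr => i _; rewrite PiE; congr (a i _); apply: psi_plant => u uB1.
  set l := letter i.
  have plant_mul v : plant (v.1, ((fgen2 i)^-1 * v.2)%g)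
      = letter_act sigma (linv l) (plant v).
    by rewrite /plant -word_act_push -val_fgen2V_mul.
  (* The neighbour of [t] may have length [q + 2], out of reach of [plant_inj]. The letter is
     therefore moved to [u], of length at most [q], and [lu] is compared with [t] itself. *)
  pose lu := (u.1, (fgen2 i * u.2)%g).
  have ulu : u = (lu.1, ((fgen2 i)^-1 * lu.2)%g) by rewrite /= mulKg; case: (u).
  have slu : small lu.2.
    rewrite val_fgen2_mul (leq_trans (size_push _ _)) // ltnS.
    by move: uB1; rewrite mem_pairs memB.
  apply/eqP/eqP => [|->]; last exact: plant_mul.
  rewrite [in plant u]ulu plant_mul => /(can_inj (letter_actK sigma (linv l))).
  by move/(plant_inj slu st) => e; rewrite ulu e.
have lower : (\sum_(g <- B') hnorm (A f g) ^+ 2) *+ 2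
    <= \sum_z hnorm (T (Pi_op H N psi) z) ^+ 2.
  rewrite -sum_pairs big_seq.
  rewrite (eq_bigr (fun t => hnorm (T (Pi_op H N psi) (plant t)) ^+ 2));
    last first.
    by move=> t; rewrite mem_pairs memB' => /T_psi ->.
  rewrite -big_seq.
  rewrite -(big_map plant predT (fun z => hnorm (T (Pi_op H N psi) z) ^+ 2)).
  rewrite big_uniq /=; last first.
    rewrite map_inj_in_uniq ?uniq_pairs // => t u.
    by rewrite !mem_pairs !memB' => st su; exact: plant_inj.
  rewrite big_mkcond; apply: ler_sum => z _; case: ifP => // _; exact: sqr_ge0.
(* The factor 2 from the copies at [x] and [y] occurs on both sides and cancels. *)
have fin : \sum_(g <- B') hnorm (A f g) ^+ 2
    <= M ^+ 2 * \sum_(g <- B) hnorm (f g) ^+ 2.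
  rewrite -(@ler_pMn2r _ 2) // -mulrnAr; apply: le_trans lower _.
  apply: le_trans (sqnorm_le_opnorm A_perm_Pi_homogeneous opnormT psi) _.
  by apply: ler_wpM2l; first exact: sqr_ge0.
apply: (@le_trans _ _ (\sum_(g <- B') hnorm (A f g) ^+ 2)%:E).
  rewrite -sumEFin; apply: esum_le_seq => // [g|g]; last first.
    by rewrite lee_fin sqr_ge0.
  rewrite memB' -ltnNge => sg.
  rewrite A_freeE fL ?(ltnW sg) // linear0 add0r big1 ?hnorm0 ?expr0n // => i _.
  rewrite fL ?linear0 // val_fgen2V_mul -ltnS.
  exact: leq_trans sg (leq_size_push _ _).
apply: (@le_trans _ _ (M ^+ 2 * \sum_(g <- B) hnorm (f g) ^+ 2)%:E).
  by rewrite lee_fin.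
rewrite [leLHS]EFinM; apply: lee_wpmul2l; first by rewrite lee_fin sqr_ge0.
rewrite -sumEFin; apply: sum_seq_le_esum => // g; by rewrite lee_fin sqr_ge0.
Qed.

End Transplant.

(** * Numerical rate and conclusion *)

Lemma rate_bound (R : realType) (d q : nat) : (1 <= d)%N ->
  1 - 2 / Num.sqrt (ln 2) * (Num.sqrt (ln (2 * d)%N%:R) / Num.sqrt q.+1%:R)
  <= q%:R / q.+2%:R :> R.
Proof.
move=> d0; have ln2 : 0 < Num.sqrt (ln (2 : R)).
  by rewrite sqrtr_gt0 ln_gt0 ?ltr1n.
have le_ln : Num.sqrt (ln 2) <= Num.sqrt (ln (2 * d)%N%:R) :> R.
  by rewrite ler_wsqrtr // ler_ln ?posrE ?ltr0n ?muln_gt0 // ler_nat leq_pmulr.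
have sq0 : 0 < Num.sqrt (q.+1%:R : R) by rewrite sqrtr_gt0.
have le_sq : Num.sqrt q.+1%:R <= q.+2%:R :> R.
  rewrite -(ler_pXn2r (n := 2)) ?nnegrE ?sqrtr_ge0 // sqr_sqrtr //.
  by rewrite -natrX ler_nat; nia.
have q2 : 0 < q.+2%:R :> R by [].
(* The actual loss is [2 / (q + 2)]. The claimed one is at least as large, because [ln (2 * d)] is
   at least [ln 2] and the root of [q + 1] at most [q + 2]. *)
have -> : q%:R / q.+2%:R = 1 - 2 / q.+2%:R :> R.
  apply: (mulIf (lt0r_neq0 q2)); rewrite mulrBl !divfK ?gt_eqF //.
  by rewrite -[q.+2]addn2 natrD; ring.
rewrite lerD2l lerN2 -mulrA ler_pM2l // mulrA ler_pdivlMr //.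
apply: le_trans (_ : 1 <= _); last by rewrite mulrC ler_pdivlMr // mul1r.
by rewrite mulrC ler_pdivrMr // mul1r.
Qed.

Theorem theorem1p6 (R : realType) :
  exists2 c : R, 0 < c &
  forall (d N : nat), (1 <= d)%N -> (1 <= N)%N ->
  forall (H1 : completeNormedModType R[i]) (ip : {dot H1 for Num.conj}),
  hilbert_inner ip ->
  forall A1 : set (H1 -> H1), unital_cstar_subalgebra ip A1 ->
  forall (a0 : H1 -> H1) (a : 'I_(d + d) -> H1 -> H1),
  A1 a0 -> (forall i, A1 (a i)) ->
  forall sigma : 'I_d -> {perm 'I_N},
  forall p : nat, (1 <= p)%N ->
  (exists x y : 'I_N,
     [/\ gball (schreier sigma) x p `&` gball (schreier sigma) y p = set0,
         acyclic_on (schreier sigma) (gball (schreier sigma) x p) &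
         acyclic_on (schreier sigma) (gball (schreier sigma) y p)]) ->
  (opnorm (A_free a0 a)
     * (1 - c * (Num.sqrt (ln (2 * d)%N%:R) / Num.sqrt p%:R))%:E
   <= opnorm (A_perm sigma a0 a \o Pi_op H1 N))%E.
Proof.
exists (2 / Num.sqrt (ln 2)).
  by rewrite divr_gt0 // sqrtr_gt0 ln_gt0 // ltr1n.
move=> d N d0 _ H ip _ A1 [A1cstar _] a0 a Aa0 Aa sigma [//|q] _.
move=> [x [y [xy acyc_x acyc_y]]].
have lin b : A1 b -> linear b by move/(cstar_bounded A1cstar) => [].
pose b0 : {linear H -> H} :=
  HB.pack a0 (GRing.isLinear.Build _ _ _ _ a0 (lin _ Aa0)).
pose b i : {linear H -> H} :=
  HB.pack (a i) (GRing.isLinear.Build _ _ _ _ (a i) (lin _ (Aa i))).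
rewrite -[a0]/(b0 : H -> H) -[a]/(fun i => b i : H -> H).
have := rate_bound R q d0; set t := 1 - _ => tq.
(* A nonpositive factor makes the claim trivial; a positive one forces [q] to be nonzero, as needed
   to divide by it. *)
have [t0|t0] := leP t 0.
  apply: le_trans (opnorm_ge0 _); apply: mule_ge0_le0; last by rewrite lee_fin.
  exact: opnorm_ge0.
have q0 : (0 < q)%N.
  by rewrite lt0n; apply: contraTneq tq => ->; rewrite mul0r -ltNge.
(* An infinite norm on the right is trivial, so the norm of the finite model is a real number
   [M]. *)
case E : (opnorm (_ \o _)) (opnorm_ge0 (A_perm sigma b0 (fun i => b i : H -> H)
  \o Pi_op H N)) => [M| |] M0; rewrite ?leey //.
have {}M0 : 0 <= M by rewrite -lee_fin.
have c0 : 0 <= q.+2%:R / q%:R * M by rewrite mulr_ge0 ?divr_ge0.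
have bound : (opnorm (A_free b0 (fun i => b i : H -> H))
    <= (q.+2%:R / q%:R * M)%:E)%E.
  apply: opnorm_le => // f f1.
  apply: le_trans (A_free_bound (transplant xy acyc_x acyc_y E) f q0) _.
  by rewrite -[leRHS]mule1; apply: lee_wpmul2l; rewrite ?lee_fin ?sqr_ge0.
apply: (@le_trans _ _ ((q.+2%:R / q%:R * M)%:E * t%:E)%E).
  by apply: lee_wpmul2r bound; rewrite lee_fin ltW.
rewrite -EFinM lee_fin.
apply: le_trans (ler_wpM2l c0 tq) _.
rewrite mulrAC -invf_div mulVf ?mul1r //.
by rewrite mulf_neq0 ?invr_eq0 ?pnatr_eq0 -?lt0n.
Qed.
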